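(* Let $n\in\mathbb N$, $n\ge3$, and let $\mathcal H_n$ be the directed $n\times n$ grid with monitor placement $\chi_{\mathtt g}$. Then $\mu(\mathcal H_n\mid\chi_{\mathtt g})=2$, under either the $\mathrm{CSP}$ or the $\mathrm{CAP}^-$ routing mechanism.
   Context: $\mathcal H_n$ is the directed graph with vertex set $[n]^2$ and an edge from $(x_1,x_2)$ to $(y_1,y_2)$ iff for some $i\in\{1,2\}$, $y_i-x_i=1$ and the other coordinate agrees. The monitor placement $\chi_{\mathtt g}=(\mathfrak m,\mathfrak M)$ has input nodes $\mathfrak m=\{(x_1,x_2): x_1=1\text{ or }x_2=1\}$ and output nodes $\mathfrak M=\{(x_1,x_2): x_1=n\text{ or }x_2=n\}$. The set of measurement paths $\mathbb P(G\mid\chi)$ (directed paths) depends on the routing mechanism: under $\mathrm{CSP}$ it consists of all simple directed paths from a node of $\mathfrak m$ to a different node of $\mathfrak M$; under $\mathrm{CAP}^-$ it consists of all directed walks starting in $\mathfrak m$ and ending in $\mathfrak M$, except single-node paths consisting of one node in $\mathfrak m\cap\mathfrak M$. For a node $v$, $\mathbb P(v)$ is the set of measurement paths through $v$, $\mathbb P(U)=\bigcup_{u\in U}\mathbb P(u)$. $V$ is $k$-identifiable if for all $U,W\subseteq V$ with $U\neq W$ and $|U|,|W|\le k$, $\mathbb P(U)\neq\mathbb P(W)$. $\mu(G\mid\chi)$ is the largest $k\ge0$ such that $V$ is $k$-identifiable. *)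

(* Defs.v *)
From mathcomp Require Import all_boot.

Set Implicit Arguments.
Unset Strict Implicit.
Unset Printing Implicit Defensive.

Record monitors (T : finType) := Monitors {
  inputs  : {set T};
  outputs : {set T}
}.

Inductive routing := CSP | CAPminus.

Section Identifiability.

Variables (T : finType) (e : rel T) (chi : monitors T) (r : routing).

(* A path is its nonempty sequence of nodes, which determines its edges
   because [e] has no parallel edges. *)
Definition admissible (x : T) (q : seq T) : bool :=
  match r with
  | CSP => uniq (x :: q) && (x != last x q)
  | CAPminus => ~~ (nilp q && (x \in inputs chi :&: outputs chi))
  end.

Definition measurement_path (p : seq T) : bool :=
  if p is x :: q then
    [&& path e x q, x \in inputs chi, last x q \in outputs chi & admissible x q]
  else false.

Definition paths_through (v : T) : pred (seq T) :=
  [pred p | measurement_path p & v \in p].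

Definition paths_through_set (U : {set T}) : pred (seq T) :=
  [pred p | [exists u in U, paths_through u p]].

Definition identifiable (k : nat) : Prop :=
  forall U W : {set T}, U != W -> #|U| <= k -> #|W| <= k ->
    ~ (paths_through_set U =1 paths_through_set W).

(* Stated as a relation because there is no largest such k when [identifiable]
   holds at k = #|T|: it then holds for every k. *)
Definition max_identifiability_is (k : nat) : Prop :=
  identifiable k /\ forall j, identifiable j -> j <= k.

End Identifiability.

(* The coordinate in {1, ..., n} of an element of {0, ..., n - 1}. *)
Definition coord (n : nat) (i : 'I_n) : nat := i.+1.

Definition grid_edge (n : nat) : rel ('I_n * 'I_n) :=
  fun x y =>
    ((coord y.1 == (coord x.1).+1) && (y.2 == x.2)) ||
    ((coord y.2 == (coord x.2).+1) && (y.1 == x.1)).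

Definition grid_monitors (n : nat) : monitors ('I_n * 'I_n)%type :=
  Monitors [set x | (coord x.1 == 1) || (coord x.2 == 1)]
           [set x | (coord x.1 == n) || (coord x.2 == n)].

(* Main.v *)
Require Import Defs.
From mathcomp Require Import all_boot.
From mathcomp Require Import zify.

Set Implicit Arguments.
Unset Strict Implicit.
Unset Printing Implicit Defensive.

(** The grid is acyclic and single nodes are never measurement paths, so both
    routing mechanisms admit the same paths.

    A node [v] outside a set [A] of at most two nodes lies on a measurement path
    avoiding [A] unless [A] consists of the two successors of [v], of its two
    predecessors, or, when [v] is both an input and an output, of its only two
    neighbours.  If two distinct sets [U] and [W] with at most two nodes had the
    same paths, every node of each set missing from the other would be obstructed
    in this way, which the geometry of the grid forbids.  Conversely, the two
    successors of the source corner meet all the paths through it, so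
    3-identifiability fails. *)

(** * Escaping a set of at most two nodes *)

(** Testing both ends makes the relation compatible with reversing edges and keeps every node of a
    nontrivial path, its first one included, out of [A]. *)
Definition avoiding (T : finType) (e : rel T) (A : {set T}) : rel T :=
  [rel x y | [&& e x y, x \notin A & y \notin A]].

Lemma path_avoiding (T : finType) (e : rel T) (A : {set T}) (x : T) (q : seq T) :
  x \notin A -> path (avoiding e A) x q ->
  path e x q && all (fun u => u \notin A) (x :: q).
Proof.
elim: q x => [|y q IH] x xA /=; first by rewrite xA.
case/andP=> /and3P[exy _ yA] /(IH _ yA) /andP[pq /= qA].
by rewrite exy pq xA.
Qed.

Lemma card_le2_eq (T : finType) (A : {set T}) (x y : T) :
  #|A| <= 2 -> x != y -> x \in A -> y \in A -> A = [set x; y].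
Proof.
move=> A2 xy xA yA; apply/esym/eqP; rewrite eqEcard cards2 xy A2 andbT.
by apply/subsetP=> z; rewrite !inE => /orP[] /eqP->.
Qed.

Lemma card_le2_mem (T : finType) (A : {set T}) (x : T) :
  #|A| <= 2 -> x \in A -> exists y, A = [set x; y].
Proof.
move=> A2 xA; have [A1|[y]] := set_0Vmem (A :\ x).
  (* A singleton is written as a pair with equal entries. *)
  by exists x; rewrite setUid -(setD1K xA) A1 setU0.
rewrite !inE => /andP[yx yA].
by exists y; apply: card_le2_eq; rewrite // eq_sym.
Qed.

(* If both successors of [N a.+1 b] lie in [A], they exhaust [A], and the
   detour through [N a b.+1] is free. *)
Lemma escape (T : finType) (e : rel T) (A : {set T}) (m : nat)
    (N : nat -> nat -> T) :
  #|A| <= 2 ->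
  (forall a b c d, a <= m -> b <= m -> c <= m -> d <= m ->
     (N a b == N c d) = (a == c) && (b == d)) ->
  (forall a b, a < m -> b <= m -> e (N a b) (N a.+1 b)) ->
  (forall a b, a <= m -> b < m -> e (N a b) (N a b.+1)) ->
  forall a b, a <= m -> b <= m -> N a b \notin A ->
  ~~ [&& a < m, b < m, N a.+1 b \in A & N a b.+1 \in A] ->
  exists c d, [/\ c <= m, d <= m, (c == m) || (d == m) &
    connect (avoiding e A) (N a b) (N c d)].
Proof.
move=> A2 NE e1 e2 a b.
have [k] := ubnP (m - a + (m - b)); elim: k a b => // k IH a b lek am bm nA.
have [hm _|] := boolP ((a == m) || (b == m)); first by exists a, b.
rewrite negb_or => /andP[anm bnm] free.
have {anm} am' : a < m by lia.
have {bnm} bm' : b < m by lia.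
have step a' b' : a' <= m -> b' <= m -> m - a' + (m - b') < k ->
    e (N a b) (N a' b') -> N a' b' \notin A ->
    ~~ [&& a' < m, b' < m, N a'.+1 b' \in A & N a' b'.+1 \in A] ->
    exists c d, [/\ c <= m, d <= m, (c == m) || (d == m) &
      connect (avoiding e A) (N a b) (N c d)].
  move=> a'm b'm lt ee nA' fr.
  have [c [d [cm dm out cd]]] := IH a' b' lt a'm b'm nA' fr.
  exists c, d; split=> //; apply: connect_trans cd; apply: connect1.
  by rewrite /avoiding /= ee nA nA'.
have s1 : N a.+1 b \notin A ->
    ~~ [&& a.+1 < m, b < m, N a.+2 b \in A & N a.+1 b.+1 \in A] ->
    exists c d, [/\ c <= m, d <= m, (c == m) || (d == m) &
      connect (avoiding e A) (N a b) (N c d)].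
  by apply: step; [lia|lia|lia|apply: e1; lia].
have s2 : N a b.+1 \notin A ->
    ~~ [&& a < m, b.+1 < m, N a.+1 b.+1 \in A & N a b.+2 \in A] ->
    exists c d, [/\ c <= m, d <= m, (c == m) || (d == m) &
      connect (avoiding e A) (N a b) (N c d)].
  by apply: step; [lia|lia|lia|apply: e2; lia].
move: free; rewrite am' bm' /= negb_and => /orP[n1|n2].
- have [/and4P[h1 h2 h3 h4]|] := boolP [&& a.+1 < m, b < m, N a.+2 b \in A
    & N a.+1 b.+1 \in A]; last exact: s1.
  have ne : N a.+2 b != N a.+1 b.+1 by rewrite NE; clear -h1 h2; lia.
  have EA := card_le2_eq A2 ne h3 h4.
  apply: s2; first by rewrite EA !inE !NE; clear -h1 h2; lia.
  (* Of the successors of [N a b.+1], [N a.+1 b.+1] lies in [A] but [N a b.+2] does not. *)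
  have [b2|] := ltnP b.+1 m; last by rewrite andbF.
  by rewrite EA !inE !NE; clear -h1 h2 b2; lia.
- have [/and4P[h1 h2 h3 h4]|] := boolP [&& a < m, b.+1 < m,
    N a.+1 b.+1 \in A & N a b.+2 \in A]; last exact: s2.
  have ne : N a.+1 b.+1 != N a b.+2 by rewrite NE; clear -h1 h2; lia.
  have EA := card_le2_eq A2 ne h3 h4.
  apply: s1; first by rewrite EA !inE !NE; clear -h1 h2; lia.
  have [b2|//] := ltnP a.+1 m.
  by rewrite EA !inE !NE; clear -h1 h2 b2; lia.
Qed.

(** * The grid in natural-number coordinates *)

(** Coordinates are zero-based; [inord] makes the map total, and it is faithful for coordinates at
    most [m]. *)
Definition node (m a b : nat) : 'I_m.+1 * 'I_m.+1 := (inord a, inord b).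

Lemma nodeP (m : nat) (v : 'I_m.+1 * 'I_m.+1) :
  exists a b, [/\ a <= m, b <= m & v = node m a b].
Proof.
case: v => a b; exists a, b.
by rewrite -ltnS ltn_ord -ltnS ltn_ord /node !inord_val.
Qed.

Lemma node_eq (m a b c d : nat) : a <= m -> b <= m -> c <= m -> d <= m ->
  (node m a b == node m c d) = (a == c) && (b == d).
Proof. by move=> *; rewrite xpair_eqE -!val_eqE /= !inordK. Qed.

Lemma edge_node (m a b c d : nat) : a <= m -> b <= m -> c <= m -> d <= m ->
  grid_edge (node m a b) (node m c d) =
  (c == a.+1) && (d == b) || (d == b.+1) && (c == a).
Proof.
by move=> *; rewrite /grid_edge /coord -!val_eqE /= !inordK.
Qed.

Lemma input_node (m a b : nat) : a <= m -> b <= m ->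
  (node m a b \in inputs (grid_monitors m.+1)) = (a == 0) || (b == 0).
Proof. by move=> *; rewrite inE /coord /= !inordK. Qed.

Lemma output_node (m a b : nat) : a <= m -> b <= m ->
  (node m a b \in outputs (grid_monitors m.+1)) = (a == m) || (b == m).
Proof. by move=> *; rewrite inE /coord /= !inordK. Qed.

(** * Measurement paths under both routing mechanisms *)

(** Each edge raises the coordinate sum [lvl] by one, so no node recurs. *)
Lemma grid_path_uniq (n : nat) (x : 'I_n * 'I_n) (q : seq ('I_n * 'I_n)) :
  path (@grid_edge n) x q -> uniq (x :: q).
Proof.
pose lvl (x : 'I_n * 'I_n) := x.1 + x.2.
move=> pq; apply: (@map_uniq _ _ lvl).
apply: (sorted_uniq ltn_trans ltnn); rewrite /= path_map.
apply: sub_path pq => u v; rewrite /grid_edge /coord /lvl /= -!val_eqE.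
by case/orP=> /andP[/eqP h1 /eqP /= h2]; lia.
Qed.

(** Since no path repeats a node, distinct ends under [CSP] just mean that there is an edge; a
    single node passing both monitor tests is exactly what [CAPminus] rules out. *)
Lemma grid_measurement_pathE (n : nat) (r : routing) (x : 'I_n * 'I_n)
    (q : seq ('I_n * 'I_n)) :
  measurement_path (@grid_edge n) (grid_monitors n) r (x :: q) =
  [&& path (@grid_edge n) x q, x \in inputs (grid_monitors n),
      last x q \in outputs (grid_monitors n) & ~~ nilp q].
Proof.
rewrite /measurement_path; case pq: (path _ x q) => //=.
case xi: (x \in _) => //=; case lo: (last x q \in _) => //=.
have := grid_path_uniq pq; case: r; rewrite /admissible.
  move=> u; rewrite u /=; case: q {pq lo} u => [|y q] /=; first by rewrite eqxx.
  by case/andP=> xq _; apply: contraNneq xq => ->; apply: mem_last.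
by case: q {pq} lo => //= lo _; rewrite in_setI xi lo.
Qed.

(** * Paths through unblocked nodes *)

(** The guards reflect that a node missing a successor is already an output, and one missing a
    predecessor already an input. The last two cases are the corners that are both. *)
Definition blocked (m : nat) (A : {set 'I_m.+1 * 'I_m.+1}) (a b : nat) : bool :=
  [|| [&& a < m, b < m, node m a.+1 b \in A & node m a b.+1 \in A],
      [&& 0 < a, 0 < b, node m a.-1 b \in A & node m a b.-1 \in A],
      [&& a == 0, b == m, node m 0 m.-1 \in A & node m 1 m \in A]
    | [&& a == m, b == 0, node m m.-1 0 \in A & node m m 1 \in A]].

Lemma reach_output (m : nat) (A : {set 'I_m.+1 * 'I_m.+1}) (a b : nat) :
  #|A| <= 2 -> a <= m -> b <= m -> node m a b \notin A ->
  ~~ [&& a < m, b < m, node m a.+1 b \in A & node m a b.+1 \in A] ->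
  exists c d, [/\ c <= m, d <= m, (c == m) || (d == m) &
    connect (avoiding (@grid_edge m.+1) A) (node m a b) (node m c d)].
Proof.
move=> A2 am bm nA free; apply: escape => // [|a' b'|a' b'] => [|h1 h2|h1 h2].
- exact: node_eq.
- by rewrite edge_node ?eqxx // ltnW.
- by rewrite edge_node ?eqxx ?orbT // ltnW.
Qed.

(* The grid rotated by a half turn and with its edges reversed is again a grid. *)
Lemma reach_input (m : nat) (A : {set 'I_m.+1 * 'I_m.+1}) (a b : nat) :
  #|A| <= 2 -> a <= m -> b <= m -> node m a b \notin A ->
  ~~ [&& 0 < a, 0 < b, node m a.-1 b \in A & node m a b.-1 \in A] ->
  exists c d, [/\ c <= m, d <= m, (c == 0) || (d == 0) &
    connect (avoiding (@grid_edge m.+1) A) (node m c d) (node m a b)].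
Proof.
move=> A2 am bm nA free.
have [|||||||c [d [cm dm out con]]] := @escape _ [rel x y | grid_edge y x] A m
  (fun a b => node m (m - a) (m - b)) A2 _ _ _ (m - a) (m - b).
- by clear => *; rewrite node_eq; lia.
- by clear => *; rewrite /= edge_node; lia.
- by clear => *; rewrite /= edge_node; lia.
- exact: leq_subr.
- exact: leq_subr.
- by rewrite !subKn.
- apply: contra free => /and4P[a0 b0]; rewrite !subnS !subKn // => -> ->.
  by move: a0 b0; clear; lia.
- exists (m - c), (m - d); rewrite !leq_subr !subn_eq0; split=> //.
    by move: out; clear -cm dm; lia.
  move: con; rewrite !subKn // => con.
  suff : connect [rel x y | avoiding (@grid_edge m.+1) A y x]
    (node m a b) (node m (m - c) (m - d)) by rewrite connect_rev.
  rewrite -(eq_connect (e := avoiding [rel x y | grid_edge y x] A)) // => x y.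
  by rewrite /avoiding /= [in LHS](andbC (x \notin A)).
Qed.

(** A free path from an input to the node is joined to a free path from the node to an output. *)
Lemma unblocked_path (m : nat) (r : routing) (A : {set 'I_m.+1 * 'I_m.+1})
    (a b : nat) :
  2 <= m -> #|A| <= 2 -> a <= m -> b <= m -> node m a b \notin A ->
  ~~ blocked A a b ->
  exists p, [/\ measurement_path (@grid_edge m.+1) (grid_monitors m.+1) r p,
    node m a b \in p & all (fun u => u \notin A) p].
Proof.
move=> m2 A2 am bm nA; rewrite /blocked !negb_or => /and4P[fO fI fC1 fC2].
(* At a corner that is both input and output the two halves could be trivial, so a two-node path
   through a free neighbour is used instead. *)
have two c d c' d' : c <= m -> d <= m -> c' <= m -> d' <= m ->
    grid_edge (node m c d) (node m c' d') ->
    (c == 0) || (d == 0) -> (c' == m) || (d' == m) ->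
    node m c d \notin A -> node m c' d' \notin A ->
    (node m a b == node m c d) || (node m a b == node m c' d') ->
    exists p, [/\ measurement_path (@grid_edge m.+1) (grid_monitors m.+1) r p,
      node m a b \in p & all (fun u => u \notin A) p].
  move=> *; exists [:: node m c d; node m c' d'].
  rewrite grid_measurement_pathE input_node //= output_node // !inE !andbT.
  split=> //; first (by apply/and3P); last by apply/andP.
have [/andP[/eqP ? /eqP ?]|nC1] := boolP ((a == 0) && (b == m)).
  subst a b; move: fC1; rewrite !eqxx /= negb_and => /orP[h|h].
    by apply: (two 0 m.-1 0 m); clear two; rewrite ?edge_node ?eqxx ?orbT //; lia.
  by apply: (two 0 m 1 m); clear two; rewrite ?edge_node ?eqxx ?orbT //; lia.
have [/andP[/eqP ? /eqP ?]|nC2] := boolP ((a == m) && (b == 0)).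
  subst a b; move: fC2; rewrite !eqxx /= negb_and => /orP[h|h].
    by apply: (two m.-1 0 m 0); clear two; rewrite ?edge_node ?eqxx ?orbT //; lia.
  by apply: (two m 0 m 1); clear two; rewrite ?edge_node ?eqxx ?orbT //; lia.
have [c [d [cm dm out cO]]] := reach_output A2 am bm nA fO.
have [c' [d' [cm' dm' inp cI]]] := reach_input A2 am bm nA fI.
have [p1 P1 L1] := connectP cI; have [p2 P2 L2] := connectP cO.
have nA' : node m c' d' \notin A.
  by case: p1 P1 L1 => [_ /= <-//|y p1 /= /andP[/and3P[]]].
have P12 : path (avoiding (@grid_edge m.+1) A) (node m c' d') (p1 ++ p2).
  by rewrite cat_path P1 -L1.
have /andP[Pe PA] := path_avoiding nA' P12.
exists (node m c' d' :: p1 ++ p2); split=> //; last first.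
  by rewrite -cat_cons mem_cat L1 mem_last.
rewrite grid_measurement_pathE Pe input_node // inp last_cat -L1 -L2.
rewrite output_node // out /=.
(* If both halves are trivial, the node is at once an input and an output, hence one of the corners
   already treated. *)
case: p1 L1 {P1 P12 Pe PA} => //= /eqP; rewrite node_eq //.
case: p2 L2 {P2} => //= /eqP; rewrite node_eq // => /andP[/eqP ? /eqP ?].
by case/andP=> /eqP ? /eqP ?; subst; move: m2 nC1 nC2 inp out; clear; lia.
Qed.

(** * Mutual blocking of two pairs of nodes *)

(* [blocked] for a two-element set, in coordinates and with the pair ordered, so
   that case analysis leaves only linear arithmetic. *)
Definition crossed (m x y a b c d : nat) : Prop :=
  (x < m /\ y < m /\ a = x.+1 /\ b = y /\ c = x /\ d = y.+1) \/
  (0 < x /\ 0 < y /\ a = x.-1 /\ b = y /\ c = x /\ d = y.-1) \/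
  (x = 0 /\ y = m /\ a = 0 /\ b = m.-1 /\ c = 1 /\ d = m) \/
  (x = m /\ y = 0 /\ a = m.-1 /\ b = 0 /\ c = m /\ d = 1).

Lemma node_pair (m a b c d a' b' c' d' : nat) :
  a <= m -> b <= m -> c <= m -> d <= m ->
  a' <= m -> b' <= m -> c' <= m -> d' <= m -> (a != c) || (b != d) ->
  node m a b \in [set node m a' b'; node m c' d'] ->
  node m c d \in [set node m a' b'; node m c' d'] ->
  [/\ a' = a, b' = b, c' = c & d' = d] \/
  [/\ c' = a, d' = b, a' = c & b' = d].
Proof.
move=> am bm cm dm am' bm' cm' dm'; rewrite !inE !node_eq // => ne.
move=> /orP[] /andP[/eqP ? /eqP ?] /orP[] /andP[/eqP ? /eqP ?]; subst;
  by [left | right | rewrite !eqxx in ne].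
Qed.

Lemma blocked_pair (m x y a b c d : nat) :
  2 <= m -> x <= m -> y <= m -> a <= m -> b <= m -> c <= m -> d <= m ->
  blocked [set node m a b; node m c d] x y ->
  crossed m x y a b c d \/ crossed m x y c d a b.
Proof.
move=> m2 xm ym am bm cm dm; rewrite /crossed.
case/or4P=> [/and4P[h1 h2 h3 h4]|/and4P[h1 h2 h3 h4]|/and4P[/eqP h1 /eqP h2 h3 h4]
    |/and4P[/eqP h1 /eqP h2 h3 h4]];
  (have [|||||||||h|h] := node_pair _ _ _ _ _ _ _ _ _ h3 h4;
    [by [] || (move: h1 h2 m2 xm ym; clear; lia) ..
    | by case: h => -> -> -> ->; tauto | by case: h => -> -> -> ->; tauto]).
Qed.

(** If [(a, b)] and [(c, d)] are the successors, or the predecessors, of [(x, y)], they make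
    incompatible demands on [(z, t)]. At a corner both demand that [(z, t)] be the node diagonal to
    it; but one of them precedes that node and the other succeeds it, so they do not block it. *)
Lemma not_all_crossed (m x y z t a b c d : nat) :
  2 <= m -> x <= m -> y <= m -> z <= m -> t <= m ->
  crossed m x y a b c d ->
  (z = a /\ t = b) \/ (z = c /\ t = d) \/
    crossed m z t a b c d \/ crossed m z t c d a b ->
  (a = z /\ b = t) \/ crossed m a b x y z t \/ crossed m a b z t x y ->
  (c = z /\ d = t) \/ crossed m c d x y z t \/ crossed m c d z t x y ->
  False.
Proof.
move=> m2 xm ym zm tm; rewrite /crossed => hv hz ha hc.
case: hv => [hv|[hv|[hv|hv]]]; case: hv => ? [? [? [? [? ?]]]]; subst.
all: case: ha => [[? ?]|[[ha|[ha|[ha|ha]]]|[ha|[ha|[ha|ha]]]]];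
  try (case: ha => ? [? [? [? [? ?]]]]); try (exfalso; clear hz hc; lia).
all: case: hc => [[? ?]|[[hc|[hc|[hc|hc]]]|[hc|[hc|[hc|hc]]]]];
  try (case: hc => ? [? [? [? [? ?]]]]); try (exfalso; clear hz; lia).
all: case: hz => [[? ?]|[[? ?]|[[hz|[hz|[hz|hz]]]|[hz|[hz|[hz|hz]]]]]];
  try (case: hz => ? [? [? [? [? ?]]]]); lia.
Qed.

(** * 2-identifiability *)

Lemma paths_through_setE (T : finType) (e : rel T) (chi : monitors T)
    (r : routing) (U : {set T}) (p : seq T) :
  paths_through_set e chi r U p =
  measurement_path e chi r p && [exists u in U, u \in p].
Proof.
rewrite /paths_through_set inE /=; apply/existsP/andP.
  by case=> u /and3P[uU mp up]; split=> //; apply/existsP; exists u; rewrite uU.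
by case=> mp /existsP[u /andP[uU up]]; exists u; apply/and3P.
Qed.

(** An unblocked node of [W] outside [U] would lie on a path that avoids [U], which only [W] would
    see. *)
Lemma same_paths_blocked (m : nat) (r : routing) (U W : {set 'I_m.+1 * 'I_m.+1})
    (a b : nat) :
  2 <= m -> #|U| <= 2 -> a <= m -> b <= m ->
  paths_through_set (@grid_edge m.+1) (grid_monitors m.+1) r W =1
    paths_through_set (@grid_edge m.+1) (grid_monitors m.+1) r U ->
  node m a b \in W -> (node m a b \in U) || blocked U a b.
Proof.
move=> m2 U2 am bm same vW; rewrite -implyNb; apply/implyP=> vU.
apply: contraT => /(unblocked_path r m2 U2 am bm vU)[p [mp vp /allP pU]].
have := same p; rewrite !paths_through_setE mp /= => /esym.
have -> : [exists u in W, u \in p] by apply/existsP; exists (node m a b); rewrite vW.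
by case/existsP=> u /andP[uU /pU]; rewrite uU.
Qed.

Lemma grid_identifiable2 (m : nat) (r : routing) : 2 <= m ->
  identifiable (@grid_edge m.+1) (grid_monitors m.+1) r 2.
Proof.
move=> m2 U W neq U2 W2 same.
wlog [v vW vU] : U W neq U2 W2 same / exists2 v, v \in W & v \notin U.
  move=> H; have [WU|/subsetPn] := boolP (W \subset U); last exact: (H U W).
  apply: (H W U) => //; first by rewrite eq_sym.
  by apply/subsetPn; apply: contra neq => UW; rewrite eqEsubset UW.
have [x [y [xm ym Ev]]] := nodeP v; subst v.
have bv : blocked U x y.
  by have := same_paths_blocked m2 U2 xm ym (fsym same) vW; rewrite (negPf vU).
(* Whatever blocks [node m x y] lies in [U], so [U] is nonempty and both sets can be written as
   pairs. *)
have [u1 u1U] : exists u, u \in U.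
  by case/or4P: bv => /and4P[_ _ h _]; [exists (node m x.+1 y)|
    exists (node m x.-1 y)|exists (node m 0 m.-1)|exists (node m m.-1 0)].
have [u2 EU] := card_le2_mem U2 u1U; have [v2 EW] := card_le2_mem W2 vW.
have [a [b [am bm E1]]] := nodeP u1; have [c [d [cm dm E2]]] := nodeP u2.
have [z [t [zm tm E3]]] := nodeP v2; subst u1 u2 v2.
have cross p q p1 q1 p2 q2 : p <= m -> q <= m -> p1 <= m -> q1 <= m ->
    p2 <= m -> q2 <= m ->
    (node m p q \in [set node m p1 q1; node m p2 q2]) ||
      blocked [set node m p1 q1; node m p2 q2] p q ->
    (p = p1 /\ q = q1) \/ (p = p2 /\ q = q2) \/
      crossed m p q p1 q1 p2 q2 \/ crossed m p q p2 q2 p1 q1.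
  move=> pm qm p1m q1m p2m q2m /orP[|/(blocked_pair m2)]; last by tauto.
  by rewrite !inE !node_eq // => /orP[] /andP[/eqP-> /eqP->]; tauto.
(* As [node m x y] is outside [U], a node of [U] lying in [W] can only be [node m z t]. *)
have vneq p q : node m p q \in U -> ~ (p = x /\ q = y).
  by move=> pU [px qy]; rewrite px qy (negPf vU) in pU.
have u2U : node m c d \in U by rewrite EU !inE eqxx orbT.
have zW : node m z t \in W by rewrite EW !inE eqxx orbT.
have := same_paths_blocked m2 U2 zm tm (fsym same) zW.
have := same_paths_blocked m2 W2 am bm same u1U.
have := same_paths_blocked m2 W2 cm dm same u2U.
rewrite EW EU => /cross hc /cross ha /cross hz.
have {}hc : (c = z /\ d = t) \/ crossed m c d x y z t \/ crossed m c d z t x y.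
  by have := vneq c d u2U; move: hc; tauto.
have {}ha : (a = z /\ b = t) \/ crossed m a b x y z t \/ crossed m a b z t x y.
  by have := vneq a b u1U; move: ha; tauto.
have {}hz := hz zm tm am bm cm dm.
rewrite EU in bv; case: (blocked_pair m2 xm ym am bm cm dm bv) => cv.
  exact: (not_all_crossed m2 xm ym zm tm cv).
(* The other order of the blocking pair: the two nodes of [U] exchange roles. *)
by apply: (not_all_crossed m2 xm ym zm tm cv) => //; tauto.
Qed.

(** * Failure of 3-identifiability *)

(* A measurement path through the corner (1,1) has at least two nodes and starts
   there, so it also passes through (1,2) or (2,1). *)
Lemma grid_identifiable_le2 (m : nat) (r : routing) (j : nat) : 2 <= m ->
  identifiable (@grid_edge m.+1) (grid_monitors m.+1) r j -> j <= 2.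
Proof.
move=> m2 idj; rewrite leqNgt; apply/negP=> j3.
have m1 : 1 <= m by apply: ltnW.
(* In zero-based coordinates [o] is the corner (1,1); adding it to its two successors gives a third
   node but no new path. *)
pose U := [set node m 0 1; node m 1 0]; pose o := node m 0 0.
have oU : o \notin U by rewrite !inE !node_eq.
have U2 : #|U| <= 2 by rewrite cards2; case: (_ != _).
apply: (idj U (o |: U)).
- by apply: contraNneq oU => ->; rewrite setU11.
- by apply: leq_trans U2 _; apply: ltnW.
- by apply: leq_trans j3; rewrite cardsU1 oU.
move=> p; rewrite !paths_through_setE; case mp: (measurement_path _ _ _ p) => //=.
apply/existsP/existsP=> -[u /andP[uU up]]; first by exists u; rewrite in_setU uU orbT.
move: uU; rewrite in_setU1 => /orP[/eqP Eu|uU]; last by exists u; rewrite uU.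
subst u; case: p mp up => // x q; rewrite grid_measurement_pathE.
case/and4P=> pq _ _ q0 oq.
have no_pred v : grid_edge v o = false.
  have [a [b [am bm ->]]] := nodeP v.
  by rewrite /o edge_node.
have ox : o = x.
  move: oq; rewrite inE => /orP[/eqP //|oq].
  case/splitPr: oq pq q0 => q1 q2.
  by rewrite cat_path /= no_pred andbF.
subst x; case: q pq q0 {oq} => // y q /= /andP[oy _] _; exists y.
rewrite !inE eqxx !orbT andbT; have [a [b [am bm Ey]]] := nodeP y; subst y.
by move: oy; rewrite /o edge_node // !node_eq //; clear; lia.
Qed.

Theorem theorem3 (n : nat) (hn : 3 <= n) (r : routing) :
  max_identifiability_is (@grid_edge n) (grid_monitors n) r 2.
Proof.
case: n hn => // m m2; split; first exact: grid_identifiable2.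
by move=> j; apply: grid_identifiable_le2.
Qed.
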